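(* Let $(S,E)$ be a finite simple graph and let $\mathcal N_{\mathbb Q}$ be the $2$-step nilpotent Lie algebra over $\mathbb Q$ associated with $(S,E)$. Let $\alpha,\beta,\gamma,\delta$ be distinct vertices in $S$ such that $\alpha\beta,\ \gamma\delta,\ \alpha\gamma,\ \alpha\delta\in E$, let $X=[\alpha,\beta]+[\gamma,\delta]\in\mathcal N_{\mathbb Q}$, and let $\mathcal H_{\mathbb Q}=\mathcal N_{\mathbb Q}/\langle X\rangle$, where $\langle X\rangle$ is the one-dimensional subspace (a central ideal) spanned by $X$. Then the Lie algebra $\mathcal H_{\mathbb Q}$ does not admit a hyperbolic automorphism whose characteristic polynomial has integer coefficients and unit constant term.
   Context: For a finite simple graph $(S,E)$ with vertex set $S$ and edge set $E$, the $2$-step nilpotent Lie algebra over $\mathbb Q$ associated with $(S,E)$ is $\mathcal N_{\mathbb Q}=V\oplus W$, where $V$ is the $\mathbb Q$-vector space with basis $S$, $W$ is the subspace of $\wedge^2V$ spanned by $\{\alpha\wedge\beta:\alpha,\beta\in S,\ \alpha\beta\in E\}$, and the bracket is the bilinear map determined by: $[\alpha,\beta]=\alpha\wedge\beta$ if $\alpha\beta\in E$ and $[\alpha,\beta]=0$ otherwise, for $\alpha,\beta\in S$; and $[V,W]=[W,W]=0$. An automorphism is hyperbolic if all of its (complex) eigenvalues have modulus different from $1$. ''Unit constant term'' means that the constant term is $\pm1$. *)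

(* Defs.v *)
From HB Require Import structures.
From mathcomp Require Import all_boot all_order all_algebra all_field.
From mathcomp Require Import generic_quotient ring_quotient.

Set Implicit Arguments.
Unset Strict Implicit.
Unset Printing Implicit Defensive.

Import Order.TTheory GRing.Theory Num.Theory.

Local Open Scope ring_scope.
Local Open Scope quotient_scope.

HB.mixin Record Vector_isLieAlgebra (K : fieldType) L of Vector K L := {
  lie : L -> L -> L;
  lie_linearl : forall y : L, linear (lie^~ y);
  lie_linearr : forall x : L, linear (lie x);
  liexx : forall x : L, lie x x = 0;
  lie_jacobi : forall x y z : L,
    lie x (lie y z) + lie y (lie z x) + lie z (lie x y) = 0
}.

#[short(type="lieAlgType")]
HB.structure Definition LieAlgebra (K : fieldType) :=
  { L of Vector_isLieAlgebra K L & Vector K L }.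

Section LieTheory.
Variables (K : fieldType) (L : lieAlgType K).
Implicit Types x y z : L.

HB.instance Definition _ x :=
  GRing.isLinear.Build K L L _ (lie x) (lie_linearr x).

Lemma lieDl x y z : lie (x + y) z = lie x z + lie y z.
Proof. by have := lie_linearl z 1 x y; rewrite !scale1r. Qed.

Lemma lie0l z : lie (0 : L) z = 0.
Proof. by apply: (addrI (lie 0 z)); rewrite -lieDl !addr0. Qed.

Lemma lieZl k x z : lie (k *: x) z = k *: lie x z.
Proof. by have := lie_linearl z k x 0; rewrite !addr0 lie0l addr0. Qed.

Lemma lieBl x y z : lie (x - y) z = lie x z - lie y z.
Proof. by rewrite -scaleN1r lieDl lieZl scaleN1r. Qed.

Lemma lieC x y : lie x y = - lie y x.
Proof.
apply/eqP; rewrite -addr_eq0; apply/eqP.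
have := liexx (x + y).
by rewrite lieDl !linearD /= !liexx add0r addr0.
Qed.

Definition central x := forall y, lie x y = 0.

Definition lie_automorphism (f : 'End(L)) :=
  bijective f /\ {morph f : x y / lie x y}.

(** The matrix of [f] in a basis of [L]; it acts on row vectors. *)
Definition end_mx (f : 'End(L)) : 'M[K]_(\dim {:L}) :=
  passmx.mxof (vbasis {:L}) (vbasis {:L}) f.

Definition end_char_poly (f : 'End(L)) : {poly K} := char_poly (end_mx f).

End LieTheory.

(** The complex eigenvalues of a rational matrix are algebraic numbers, so they
    all lie in [algC], the field of complex algebraic numbers. *)
Definition hyperbolic (L : lieAlgType rat) (f : 'End(L)) :=
  forall z : algC, eigenvalue (map_mx ratr (end_mx f)) z -> `|z| != 1.

Record lieIdeal (K : fieldType) (L : lieAlgType K) := LieIdeal {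
  ideal_vspace :> {vspace L};
  ideal_lie : forall x y : L, y \in ideal_vspace -> lie x y \in ideal_vspace
}.

(** The library only makes this quotient by an additive subgroup a [zmodType].
    The scaling and the bracket are defined below on representatives; they do
    not depend on the choice of these, see [quot_scaleE] and [quot_lieE]. *)
Definition lie_quot (K : fieldType) (L : lieAlgType K) (I : lieIdeal L) :=
  Quotient.quot (pred_of_vspace I : zmodClosed L).

Section LieQuotient.
Import VectorInternalTheory.
Variables (K : fieldType) (L : lieAlgType K) (I : lieIdeal L).
Local Notation Q := (lie_quot I).

HB.instance Definition _ := GRing.Zmodule.on Q.

Definition lie_proj (x : L) : Q := \pi_Q x.

Definition lie_repr (q : Q) : L := repr q.

Lemma lie_reprK : cancel lie_repr lie_proj.
Proof. exact: reprK. Qed.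

Lemma lie_proj_eqP x y : reflect (lie_proj x = lie_proj y) (x - y \in I).
Proof.
by rewrite [x - y \in I](Quotient.idealrBE (pred_of_vspace I)); apply: eqP.
Qed.

Lemma lie_projD x y : lie_proj (x + y) = lie_proj x + lie_proj y.
Proof. exact: (@Quotient.pi_add L (pred_of_vspace I)). Qed.

Lemma lie_proj_repr x : lie_repr (lie_proj x) - x \in I.
Proof. by apply/lie_proj_eqP; rewrite lie_reprK. Qed.

Definition quot_scale (k : K) (q : Q) : Q := lie_proj (k *: lie_repr q).

Definition quot_lie (p q : Q) : Q := lie_proj (lie (lie_repr p) (lie_repr q)).

Lemma quot_scaleE k x : quot_scale k (lie_proj x) = lie_proj (k *: x).
Proof. by apply/lie_proj_eqP; rewrite -scalerBr memvZ ?lie_proj_repr. Qed.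

Lemma quot_lieE x y : quot_lie (lie_proj x) (lie_proj y) = lie_proj (lie x y).
Proof.
apply/lie_proj_eqP; set x' := lie_repr _; set y' := lie_repr _.
have ->: lie x' y' - lie x y = lie x' (y' - y) - lie y (x' - x).
  by rewrite linearB /= (lieC y (x' - x)) opprK lieBl addrA subrK.
by rewrite rpredB ?ideal_lie ?lie_proj_repr.
Qed.

Fact quot_scaleA j k q : quot_scale j (quot_scale k q) = quot_scale (j * k) q.
Proof. by rewrite -(lie_reprK q) !quot_scaleE scalerA. Qed.

Fact quot_scale1 : left_id 1 quot_scale.
Proof. by move=> q; rewrite -(lie_reprK q) quot_scaleE scale1r. Qed.

Fact quot_scaleDr : right_distributive quot_scale +%R.
Proof.
move=> k p q; rewrite -(lie_reprK p) -(lie_reprK q) -lie_projD !quot_scaleE.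
by rewrite scalerDr lie_projD.
Qed.

Fact quot_scaleDl q : {morph quot_scale^~ q : j k / j + k}.
Proof.
by move=> j k; rewrite -(lie_reprK q) !quot_scaleE scalerDl lie_projD.
Qed.

HB.instance Definition _ := GRing.Zmodule_isLmodule.Build K Q
  quot_scaleA quot_scale1 quot_scaleDr quot_scaleDl.

Lemma lie_projZ k x : lie_proj (k *: x) = k *: lie_proj x.
Proof. by rewrite -quot_scaleE. Qed.

Fact lie_proj_linear : linear lie_proj.
Proof. by move=> k x y; rewrite lie_projD lie_projZ. Qed.

HB.instance Definition _ := GRing.isLinear.Build K L Q _ lie_proj lie_proj_linear.

Lemma lie_proj_eq0 x : (lie_proj x == 0) = (x \in I).
Proof.
by rewrite -(linear0 lie_proj); apply/eqP/idP => [/lie_proj_eqP|xI];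
  [rewrite subr0 | apply/lie_proj_eqP; rewrite subr0].
Qed.

Fact quot_vect_iso : Vector.axiom (dim (subvs_of I^C)) Q.
Proof.
pose h (s : subvs_of I^C) := lie_proj (vsval s).
pose g (q : Q) := vsproj I^C (daddv_pi I^C I (lie_repr q)).
have hlin : linear h by move=> k s t; rewrite /h -lie_proj_linear linearP.
pose hL : {linear _ -> _} := HB.pack h (GRing.isLinear.Build _ _ _ _ h hlin).
have dIC : (I^C :&: I = 0)%VS by rewrite capvC capv_compl.
have hg : cancel g h.
  move=> q; rewrite -[RHS]lie_reprK /h /g vsprojK ?memv_pi //.
  apply/lie_proj_eqP; rewrite -memvN opprB.
  have := daddv_pi_add dIC (w := lie_repr q).
  rewrite addvC addv_complf memvf => /(_ isT) E.
  by rewrite -{1}E addrC addKr memv_pi.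
have hinj : injective h.
  move=> s t /lie_proj_eqP; rewrite -linearB /= => stI.
  apply/eqP; rewrite -subr_eq0 -(inj_eq val_inj) /= -memv0 -dIC memv_cap stI.
  by rewrite andbT rpredB ?subvsP.
have gh : cancel h g by move=> s; apply: hinj; rewrite hg.
have glin : linear g by apply: (can2_linear (f := hL)) gh hg.
exists (v2r \o g) => [k p q|] /=.
  by rewrite glin linearP.
exists (h \o r2v) => x /=.
  by rewrite v2rK hg.
by rewrite gh r2vK.
Qed.

HB.instance Definition _ := Lmodule_hasFinDim.Build K Q quot_vect_iso.

Fact quot_lie_linearl q : linear (quot_lie^~ q).
Proof.
move=> k x y; rewrite -(lie_reprK x) -(lie_reprK y) -(lie_reprK q).
by rewrite -linearP !quot_lieE lieDl lieZl linearP.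
Qed.

Fact quot_lie_linearr p : linear (quot_lie p).
Proof.
move=> k x y; rewrite -(lie_reprK x) -(lie_reprK y) -(lie_reprK p).
by rewrite -linearP !quot_lieE !linearP.
Qed.

Fact quot_liexx q : quot_lie q q = 0.
Proof. by rewrite -(lie_reprK q) quot_lieE liexx linear0. Qed.

Fact quot_lie_jacobi x y z :
  quot_lie x (quot_lie y z) + quot_lie y (quot_lie z x)
    + quot_lie z (quot_lie x y) = 0.
Proof.
rewrite -(lie_reprK x) -(lie_reprK y) -(lie_reprK z) !quot_lieE -!linearD /=.
by rewrite lie_jacobi linear0.
Qed.

HB.instance Definition _ := Vector_isLieAlgebra.Build K Q
  quot_lie_linearl quot_lie_linearr quot_liexx quot_lie_jacobi.

Lemma lie_projM x y : lie_proj (lie x y) = lie (lie_proj x) (lie_proj y).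
Proof. by rewrite -quot_lieE. Qed.

End LieQuotient.

Section CentralLine.
Variables (K : fieldType) (L : lieAlgType K) (z : L) (cz : central z).

Fact central_line_lie (x y : L) : y \in <[z]>%VS -> lie x y \in <[z]>%VS.
Proof. by case/vlineP=> k ->; rewrite linearZ /= lieC cz oppr0 scaler0 mem0v. Qed.

Definition central_line := LieIdeal central_line_lie.

End CentralLine.

Record sgraph := SGraph {
  vertex :> finType;
  edge : rel vertex;
  edge_sym : symmetric edge;
  edge_irr : irreflexive edge
}.

Section GraphLie.
Variable G : sgraph.

(** [V] is the space of functions on the vertices, with the indicator functions
    [basisV a] as basis, and the exterior square of [V] is realized inside the
    tensor square by [u /\ v = u (x) v - v (x) u]. *)
Definition spaceV := {ffun G -> rat^o}.
Definition tensorV := {ffun G * G -> rat^o}.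

HB.instance Definition _ := Vector.on spaceV.
HB.instance Definition _ := Vector.on tensorV.

Definition basisV (a : G) : spaceV := [ffun x => (x == a)%:R].

Definition wedge (u v : spaceV) : tensorV :=
  [ffun p => u p.1 * v p.2 - v p.1 * u p.2].

Definition spaceW : {vspace tensorV} :=
  (\sum_(p : G * G | edge p.1 p.2) <[wedge (basisV p.1) (basisV p.2)]>)%VS.

Definition graph_lie := (spaceV * subvs_of spaceW)%type.

HB.instance Definition _ := Vector.on graph_lie.

Definition basis_bracket (a b : G) : tensorV :=
  if edge a b then wedge (basisV a) (basisV b) else 0.

Definition bracketV (u v : spaceV) : tensorV :=
  \sum_a \sum_b (u a * v b) *: basis_bracket a b.

(** [vsproj spaceW] only retypes [bracketV x.1 y.1], which lies in [spaceW]
    by [bracketV_in]. *)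
Definition graph_bracket (x y : graph_lie) : graph_lie :=
  (0, vsproj spaceW (bracketV x.1 y.1)).

Lemma bracketV_in u v : bracketV u v \in spaceW.
Proof.
apply: rpred_sum => a _; apply: rpred_sum => b _; apply: rpredZ.
rewrite /basis_bracket; case: ifP => [eab|_]; last exact: mem0v.
by rewrite memvE (sumv_sup (a, b)).
Qed.

Lemma wedgexx u : wedge u u = 0.
Proof. by apply/ffunP=> p; rewrite !ffunE mulrC subrr. Qed.

Lemma wedgeC u v : wedge u v = - wedge v u.
Proof. by apply/ffunP=> p; rewrite !ffunE opprB. Qed.

Lemma basis_bracketC a b : basis_bracket a b = - basis_bracket b a.
Proof.
by rewrite /basis_bracket edge_sym; case: ifP; rewrite ?oppr0 // wedgeC.
Qed.

Lemma bracketV_linearl v : linear (bracketV^~ v).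
Proof.
move=> k u w; rewrite /bracketV scaler_sumr -big_split; apply: eq_bigr => a _.
rewrite /= scaler_sumr -big_split; apply: eq_bigr => b _ /=.
by rewrite !ffunE mulrDl scalerDl scalerA mulrA.
Qed.

Lemma bracketVC u v : bracketV u v = - bracketV v u.
Proof.
rewrite /bracketV exchange_big /= -sumrN; apply: eq_bigr => a _.
rewrite -sumrN; apply: eq_bigr => b _.
by rewrite basis_bracketC scalerN mulrC.
Qed.

Lemma bracketV_linearr u : linear (bracketV u).
Proof.
move=> k v w; rewrite bracketVC bracketV_linearl opprD -scalerN.
by rewrite -!(bracketVC u).
Qed.

Lemma bracketVxx u : bracketV u u = 0.
Proof.
apply/ffunP=> p; have /ffunP/(_ p) := bracketVC u u.
by rewrite !ffunE => /eqP; rewrite -addr_eq0 -mulr2n mulrn_eq0 => /eqP.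
Qed.

Lemma bracketV0 u : bracketV u 0 = 0.
Proof.
by rewrite /bracketV big1 // => a _; rewrite big1 // => b _;
   rewrite ffunE mulr0 scale0r.
Qed.

Fact graph_linearl y : linear (graph_bracket^~ y).
Proof.
move=> k x z; rewrite /graph_bracket /= bracketV_linearl linearP.
by congr (_, _); rewrite /= scaler0 addr0.
Qed.

Fact graph_linearr x : linear (graph_bracket x).
Proof.
move=> k y z; rewrite /graph_bracket /= bracketV_linearr linearP.
by congr (_, _); rewrite /= scaler0 addr0.
Qed.

Fact graph_liexx x : graph_bracket x x = 0.
Proof. by rewrite /graph_bracket bracketVxx linear0. Qed.

Fact graph_bracket2 x y z : graph_bracket x (graph_bracket y z) = 0.
Proof. by rewrite /graph_bracket /= bracketV0 linear0. Qed.

Fact graph_jacobi x y z :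
  graph_bracket x (graph_bracket y z) + graph_bracket y (graph_bracket z x)
    + graph_bracket z (graph_bracket x y) = 0.
Proof. by rewrite !graph_bracket2 !addr0. Qed.

HB.instance Definition _ := Vector_isLieAlgebra.Build rat graph_lie
  graph_linearl graph_linearr graph_liexx graph_jacobi.

Definition vtx (a : G) : graph_lie := (basisV a, 0).

Lemma lie_vtx (a b : G) :
  lie (vtx a) (vtx b) = (0, vsproj spaceW (basis_bracket a b)).
Proof.
congr (_, vsproj _ _); rewrite /= /bracketV (bigD1 a) //= (bigD1 b) //=.
rewrite !ffunE !eqxx mulr1 scale1r !big1 ?addr0 // => [c ca | d db].
  by rewrite big1 // => d _; rewrite !ffunE (negPf ca) mul0r scale0r.
by rewrite !ffunE (negPf db) mulr0 scale0r.
Qed.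

Definition edge_pair (a b c d : G) : graph_lie :=
  lie (vtx a) (vtx b) + lie (vtx c) (vtx d).

Fact edge_pair_central a b c d : central (edge_pair a b c d).
Proof.
by move=> y; rewrite lieC linearD /= [lie y _]graph_bracket2
  [X in _ + X]graph_bracket2 addr0 oppr0.
Qed.

Definition graph_quot (a b c d : G) :=
  lie_quot (central_line (@edge_pair_central a b c d)).

HB.instance Definition _ a b c d := LieAlgebra.on (graph_quot a b c d).

End GraphLie.

(* Main.v *)
Require Import Defs.
From HB Require Import structures.
From mathcomp Require Import all_boot all_order all_algebra all_field.
From mathcomp Require Import ring.

(** Every automorphism [f] of the quotient has a rational eigenvalue; being a
    root of a monic integral polynomial with unit constant term, it is [1] or
    [-1].

    A bracket in the line of [X] vanishes: if [u /\ v] has coordinates [t] at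
    [ab] and [cd], and [0] at [ac] and [ad], the Pluecker relation gives
    [t ^ 2 = 0].  So arbitrary lifts of the images of non-adjacent vertices
    commute, hence [f] lifts to an endomorphism [g] of the graph Lie algebra, and
    [g X = mu X] for a rational [mu].  Suppose that [mu] is not an eigenvalue of
    [f].  Then [ker (g - mu)] is contained in the line of [X], and [X] is not in
    the image of [g - mu].  Over the algebraic numbers, let [u] and [v] be
    generalized eigenvectors of [g] for [l] and [m].  If [l * m = mu], the bracket
    of [u] and [v] is killed by a power of [g - mu]; by induction on this power it
    is in the line of [X], so it vanishes.  Otherwise it is in the image of
    [g - mu].  Therefore all brackets are in this image, and so is [X], a
    contradiction. *)

Set Implicit Arguments.
Unset Strict Implicit.
Unset Printing Implicit Defensive.

Import Order.TTheory GRing.Theory Num.Theory.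
Import passmx.

Local Open Scope ring_scope.

(** * Bilinear maps and generalized eigenspaces *)

(** The characteristic polynomial splits into linear factors, and coprimality of their powers makes
    the whole space the sum of the generalized eigenspaces. *)
Lemma geigenspace_ind (F : closedFieldType) n (g : 'M[F]_n) (P : 'rV[F]_n -> Prop) :
  P 0 -> (forall u v, P u -> P v -> P (u + v)) ->
  (forall a u, (u <= geigenspace g a)%MS -> P u) -> forall u, P u.
Proof.
case: n => [|n] in g P * => P0 PD Pg u; first by rewrite thinmx0.
have [r Dp] := closed_field_poly_normal (char_poly g).
rewrite (monicP (char_poly_monic g)) scale1r in Dp.
(* The exponent [n.+1] is the one built into [geigenspace]; it bounds every multiplicity, so the
   product still annihilates [g]. *)
pose s := undup r; pose p_ (i : 'I_(size s)) := ('X - (s`_i)%:P) ^+ n.+1.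
have dvd_p : mxminpoly g %| \prod_i p_ i.
  apply: dvdp_trans (mxminpoly_dvd_char g) _; rewrite Dp.
  rewrite -prodr_undup_exp_count -/s (big_nth 0) big_mkord.
  apply: (big_ind2 (fun p q => p %| q)) => [|p p' q q'|i _].
  - exact: dvdpp.
  - exact: dvdp_mul.
  apply: dvdp_exp2l; have <- : size r = n.+1.
    by apply/succn_inj; rewrite -(size_char_poly g) Dp size_prod_XsubC.
  exact: count_size.
have p_coprime : {in predT &, forall i j, j != i -> coprimep (p_ i) (p_ j)}.
  move=> i j _ _ ji; apply: coprimep_expl; apply: coprimep_expr.
  by rewrite coprimep_XsubC root_XsubC nth_uniq ?undup_uniq // eq_sym.
have /sub_sumsmxP[w ->] : (u <= \sum_i kermxpoly g (p_ i))%MS.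
  by rewrite -(kermxpoly_prod g p_coprime) (kermxpoly_min dvd_p) submx1.
by apply: big_ind => // i _; apply: Pg (submxMl _ _).
Qed.

(** Double induction on the exponents with which [g - a] kills [u] and [g - b] kills [v]. The
    hypothesis on [S] concerns the image of [B u v] under [g - a * b], written so that [mu]
    shows. *)
Lemma bilinear_geigenspace (F : fieldType) n (g S : 'M[F]_n) (mu a b : F)
    (B : {bilinear 'rV[F]_n -> 'rV[F]_n -> 'rV[F]_n}) :
    (forall u v, B u v *m g = B (u *m g) (v *m g)) ->
    (forall u v, (B u v *m (g - mu%:M) - (a * b - mu) *: B u v <= S)%MS ->
       (B u v <= S)%MS) ->
  forall u v, (u <= geigenspace g a)%MS -> (v <= geigenspace g b)%MS ->
  (B u v <= S)%MS.
Proof.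
case: n => [|n] in g S B * => gB stepS.
  by move=> u v; rewrite [B u v]thinmx0 sub0mx.
suff nilB i j u v : u *m (g - a%:M) ^+ i = 0 -> v *m (g - b%:M) ^+ j = 0 ->
    (B u v <= S)%MS.
  by move=> u v; rewrite !geigenspaceE => /sub_kermxP + /sub_kermxP; apply: nilB.
elim: i j u v => [|i IHi] j u v ui0.
  by move: ui0; rewrite expr0 mulmx1 => -> *; rewrite linear0l sub0mx.
move: ui0; rewrite exprS mulmxA => {}/IHi IHi vj0.
move: vj0; elim: j v => [|j IHj] v.
  by rewrite expr0 mulmx1 => -> *; rewrite linear0r sub0mx.
rewrite exprS mulmxA => /[dup] vj0 /IHj{}IHj.
apply: stepS; set u' := u *m _ in IHi; set v' := v *m _ in vj0 IHj.
have Eu : u *m g = a *: u + u' by rewrite /u' mulmxBr mul_mx_scalar subrKC.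
have Ev : v *m g = b *: v + v' by rewrite /v' mulmxBr mul_mx_scalar subrKC.
(* Every term on the right contains [u'] or [v'], which have smaller exponents than [u] and [v]. *)
have -> : B u v *m (g - mu%:M) - (a * b - mu) *: B u v
        = a *: B u v' + b *: B u' v + B u' v'.
  rewrite mulmxBr mul_mx_scalar gB Eu Ev linearDl !linearDr /=.
  rewrite ?linearZl_LR ?linearZr_LR /= ?linearZr_LR.
  by apply/rowP=> k; rewrite !mxE; ring.
rewrite !addmx_sub ?scalemx_sub //; last exact: IHi vj0.
by apply: (IHi j.+1); rewrite exprS mulmxA.
Qed.

Lemma bilinear_sub_image (F : closedFieldType) n (g : 'M[F]_n) (mu : F) (x : 'rV[F]_n)
    (B : {bilinear 'rV[F]_n -> 'rV[F]_n -> 'rV[F]_n}) :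
    (forall u v, B u v *m g = B (u *m g) (v *m g)) ->
    (forall w : 'rV_n, w *m (g - mu%:M) = 0 -> (w <= x)%MS) ->
    (forall u v, (B u v <= x)%MS -> B u v = 0) ->
  forall u v, (B u v <= g - mu%:M)%MS.
Proof.
move=> gB ker_g xB.
apply: (@geigenspace_ind _ _ g) => [v|u1 u2 IH1 IH2 v|a u ga].
- by rewrite linear0l sub0mx.
- by rewrite linearDl addmx_sub.
apply: (@geigenspace_ind _ _ g) => [|v1 v2 IH1 IH2|b v gb].
- by rewrite linear0r sub0mx.
- by rewrite linearDr addmx_sub.
(* If [a * b] differs from [mu], take for [S] the image of [g - mu]: the premise then places a
   nonzero multiple of [B u v] in it. *)
have [ab|ab] := eqVneq (a * b) mu; last first.
  apply: (bilinear_geigenspace (mu := mu) gB) ga gb => {}u {}v.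
  rewrite -subr_eq0 in ab; move=> BS.
  suff: ((a * b - mu) *: B u v <= g - mu%:M)%MS by rewrite eqmx_scale.
  rewrite -[_ *: _](subKr (B u v *m (g - mu%:M))).
  by rewrite addmx_sub ?eqmx_opp ?submxMl.
(* If [a * b = mu], take [S = 0]: the premise says that [g - mu] kills [B u v], which is therefore
   in the line of [x] and vanishes. *)
suff /submx0null-> : (B u v <= (0 : 'M_n))%MS by rewrite sub0mx.
apply: (bilinear_geigenspace (mu := mu) gB) ga gb => {}u {}v.
rewrite ab subrr scale0r subr0 => /submx0null/ker_g/xB ->.
exact: sub0mx.
Qed.

(** * Extension of scalars *)

Section BilinMx.
Variables (R : comNzRingType) (m n p : nat).

(** Bilinear maps are encoded by matrices on the tensor product, so that
    [map_mx] extends their scalars. *)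
Definition bilin_mx (K : 'M[R]_(m * n, p)) (u : 'rV_m) (v : 'rV_n) : 'rV_p :=
  mxvec (u^T *m v) *m K.

Fact bilin_mx_bilinear K : bilinear_for *:%R *:%R (bilin_mx K).
Proof.
split=> [v k u u'|u k v v']; rewrite /bilin_mx.
  by rewrite linearP /= mulmxDl -scalemxAl linearP mulmxDl -scalemxAl.
by rewrite mulmxDr -scalemxAr linearP mulmxDl -scalemxAl.
Qed.

HB.instance Definition _ K :=
  bilinear_isBilinear.Build R _ _ _ _ _ (bilin_mx K) (bilin_mx_bilinear K).

Lemma bilin_mxP (B : {bilinear 'rV[R]_m -> 'rV[R]_n -> 'rV[R]_p}) :
  {K | forall u v, B u v = bilin_mx K u v}.
Proof.
pose b (w : 'rV_(m * n)) :=
  \sum_i \sum_j vec_mx w i j *: B (delta_mx 0 i) (delta_mx 0 j).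
have b_lin : linear b.
  move=> k w w'; rewrite /b scaler_sumr -big_split; apply: eq_bigr => i _ /=.
  rewrite scaler_sumr -big_split; apply: eq_bigr => j _ /=.
  by rewrite linearP !mxE scalerDl scalerA.
pose bL : {linear _ -> _} := HB.pack b (GRing.isLinear.Build _ _ _ _ b b_lin).
exists (lin1_mx bL) => u v; rewrite /bilin_mx mul_rV_lin1 /= /b mxvecK.
rewrite {1}[u]row_sum_delta linear_sumlz; apply: eq_bigr => i _.
rewrite {1}[v]row_sum_delta linear_sumr; apply: eq_bigr => j _.
by rewrite linearZl_LR linearZr_LR /= scalerA !mxE big_ord1 !mxE.
Qed.

End BilinMx.

(** Matrix units are tensors [u^T *m v] with entries in [aF], and they span the matrices over [rF].
    This carries identities between bilinear maps through an extension of scalars. *)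
Lemma map_mx_linear_ext (aF : nzRingType) (rF : comNzRingType)
    (f : {rmorphism aF -> rF}) m n (V : lmodType rF)
    (L1 L2 : {linear 'M[rF]_(m, n) -> V}) :
    (forall (u : 'rV[aF]_m) (v : 'rV[aF]_n),
       L1 (map_mx f (u^T *m v)) = L2 (map_mx f (u^T *m v))) ->
  forall A, L1 A = L2 A.
Proof.
move=> L12 A; rewrite [A]matrix_sum_delta !linear_sum; apply: eq_bigr => i _.
rewrite !linear_sum; apply: eq_bigr => j _; rewrite !linearZ; congr (_ *: _).
have := L12 (delta_mx 0 i) (delta_mx 0 j).
by rewrite trmx_delta mul_delta_mx map_delta_mx.
Qed.

(** For the minors [p_ij = u_i v_j - v_i u_j], the Pluecker relation reads
    [p12 * p34 = p13 * p24 - p14 * p23], so [t ^ 2 = 0]. *)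
Lemma decomposable_pair_eq0 (F : idomainType) (u1 u2 u3 u4 v1 v2 v3 v4 t : F) :
  u1 * v2 - v1 * u2 = t -> u3 * v4 - v3 * u4 = t ->
  u1 * v3 - v1 * u3 = 0 -> u1 * v4 - v1 * u4 = 0 -> t = 0.
Proof.
move=> E12 E34 E13 E14; apply/eqP; rewrite -sqrf_eq0 expr2 -{1}E12 -E34.
have -> : (u1 * v2 - v1 * u2) * (u3 * v4 - v3 * u4)
  = (u1 * v3 - v1 * u3) * (u2 * v4 - v2 * u4)
    - (u1 * v4 - v1 * u4) * (u2 * v3 - v2 * u3) by ring.
by rewrite E13 E14 !mul0r subrr.
Qed.

Section WedgeMx.
Variables (R : comNzRingType) (n : nat).

(** The alternating form of [p] and [q], as a linear function of tensors so that [map_mx_linear_ext]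
    applies to it. *)
Definition wedge_mx (p q : 'cV[R]_n) (A : 'M[R]_n) : 'M[R]_1 :=
  p^T *m A *m q - q^T *m A *m p.

Fact wedge_mx_linear p q : linear (wedge_mx p q).
Proof.
move=> k A A'; rewrite /wedge_mx !mulmxDr !mulmxDl -!scalemxAr -!scalemxAl.
by rewrite scalerBr opprD addrACA.
Qed.

HB.instance Definition _ p q :=
  GRing.isLinear.Build R _ _ _ (wedge_mx p q) (wedge_mx_linear p q).

Lemma wedge_mxE p q (u v : 'rV[R]_n) :
  wedge_mx p q (u^T *m v) = ((u *m p) 0 0 * (v *m q) 0 0 - (v *m p) 0 0 * (u *m q) 0 0)%:M.
Proof.
apply/rowP=> i; rewrite ord1 /wedge_mx !mulmxA -!trmx_mul -!mulmxA.
rewrite [LHS]mxE [X in _ + X]mxE [X in X - _]mxE [X in _ - X]mxE !big_ord1.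
rewrite [X in X * _ - _]mxE [X in _ - X * _]mxE [RHS]mxE mulr1n.
by rewrite (mulrC ((v *m p) 0 0)).
Qed.

End WedgeMx.

Lemma map_wedge_mx (aR rR : comNzRingType) (f : {rmorphism aR -> rR}) n
    (p q : 'cV[aR]_n) A :
  map_mx f (wedge_mx p q A) = wedge_mx (map_mx f p) (map_mx f q) (map_mx f A).
Proof. by rewrite map_mxB !map_mxM -!map_trmx. Qed.

Lemma map_bilin_mx (aR rR : comNzRingType) (f : {rmorphism aR -> rR}) m n p
    (K : 'M[aR]_(m * n, p)) u v :
  map_mx f (bilin_mx K u v) = bilin_mx (map_mx f K) (map_mx f u) (map_mx f v).
Proof. by rewrite map_mxM map_mxvec map_mxM -map_trmx. Qed.

Lemma map_bilin_mx_wedge (aR rR : comNzRingType) (f : {rmorphism aR -> rR}) n r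
    (K : 'M[aR]_(n * n, r)) (m : 'cV_r) (p q : 'cV_n) :
    (forall u v, bilin_mx K u v *m m = wedge_mx p q (u^T *m v)) ->
  forall u v, bilin_mx (map_mx f K) u v *m map_mx f m
              = wedge_mx (map_mx f p) (map_mx f q) (u^T *m v).
Proof.
move=> Km u v; rewrite /bilin_mx.
pose L : {linear 'M_n -> _} := mulmxr (map_mx f m) \o mulmxr (map_mx f K) \o mxvec.
apply: (@map_mx_linear_ext _ _ f _ _ _ L (wedge_mx _ _)) => {}u {}v /=.
by rewrite -map_wedge_mx -map_mxvec -!map_mxM -Km.
Qed.

Lemma map_bilin_mx_morph (aR rR : comNzRingType) (f : {rmorphism aR -> rR}) n
    (K : 'M[aR]_(n * n, n)) (g : 'M_n) :
    (forall u v, bilin_mx K u v *m g = bilin_mx K (u *m g) (v *m g)) ->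
  forall u v, bilin_mx (map_mx f K) u v *m map_mx f g
              = bilin_mx (map_mx f K) (u *m map_mx f g) (v *m map_mx f g).
Proof.
move=> Kg u v; rewrite /bilin_mx trmx_mul mulmxA -(mulmxA _ _ v).
set G := map_mx f g; set M := map_mx f K.
pose L1 : {linear 'M_n -> _} := mulmxr G \o mulmxr M \o mxvec.
pose L2 : {linear 'M_n -> _} := mulmxr M \o mxvec \o mulmxr G \o mulmx G^T.
apply: (@map_mx_linear_ext _ _ f _ _ _ L1 L2) => {}u {}v /=.
rewrite map_trmx -!map_mxM -!map_mxvec -!map_mxM; congr map_mx.
by have := Kg u v; rewrite /bilin_mx trmx_mul !mulmxA.
Qed.

(** The spectral argument takes place over [algC]; the inclusion of row spaces descends to [rat] by
    [map_submx]. The columns [p1] to [p4] stand for the coordinates at [a], [b], [c], [d], and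
    [m12], [m34], [m13], [m14] for those at [ab], [cd], [ac], [ad]. *)
Lemma sub_image_mx n (g : 'M[rat]_n) (mu : rat)
    (B : {bilinear 'rV[rat]_n -> 'rV[rat]_n -> 'rV[rat]_n})
    (x a1 a2 a3 a4 : 'rV_n) (m12 m34 m13 m14 p1 p2 p3 p4 : 'cV[rat]_n) :
    (forall u v, B u v *m g = B (u *m g) (v *m g)) ->
    (forall w : 'rV_n, w *m (g - mu%:M) = 0 -> (w <= x)%MS) ->
    (forall u v, B u v *m m12 = wedge_mx p1 p2 (u^T *m v)) ->
    (forall u v, B u v *m m34 = wedge_mx p3 p4 (u^T *m v)) ->
    (forall u v, B u v *m m13 = wedge_mx p1 p3 (u^T *m v)) ->
    (forall u v, B u v *m m14 = wedge_mx p1 p4 (u^T *m v)) ->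
    [/\ x *m m12 = 1, x *m m34 = 1, x *m m13 = 0 & x *m m14 = 0] ->
    x = B a1 a2 + B a3 a4 ->
  (x <= g - mu%:M)%MS.
Proof.
have [K BK] := bilin_mxP B.
move=> gB ker_g B12 B34 B13 B14 [x12 x34 x13 x14] Dx.
pose f : {rmorphism rat -> algC} := ratr.
pose KC := map_mx f K.
have gK u v : bilin_mx K u v *m g = bilin_mx K (u *m g) (v *m g).
  by rewrite -!BK.
rewrite -(map_submx f) map_mxB map_scalar_mx Dx map_mxD !BK !map_bilin_mx -/KC.
have imB : forall u v, (bilin_mx KC u v <= map_mx f g - (f mu)%:M)%MS.
  apply: (bilinear_sub_image (x := map_mx f x)).
  - exact: map_bilin_mx_morph.
  (* The kernel of the extended matrix is the extension of the rational kernel, so it stays in the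
     line of [x]. *)
  - move=> w /sub_kermxP wg; apply: submx_trans wg _.
    rewrite -map_scalar_mx -map_mxB -map_kermx map_submx.
    by apply/row_subP=> i; apply/ker_g/sub_kermxP/row_sub.
  move=> u v /sub_rVP[t Bt]; rewrite Bt.
  have E m p q c : (forall u v, B u v *m m = wedge_mx p q (u^T *m v)) ->
      x *m m = c%:M ->
    (u *m map_mx f p) 0 0 * (v *m map_mx f q) 0 0
    - (v *m map_mx f p) 0 0 * (u *m map_mx f q) 0 0 = t * f c.
    move=> Bm xm; have Km u' v' : bilin_mx K u' v' *m m = wedge_mx p q (u'^T *m v').
      by rewrite -BK.
    have := map_bilin_mx_wedge f Km u v; rewrite wedge_mxE -/KC Bt -scalemxAl.
    rewrite -map_mxM xm map_scalar_mx => /rowP/(_ 0).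
    by rewrite !mxE !mulr1n.
  have t0 : t = 0.
    have := (E _ _ _ _ B12 x12, E _ _ _ _ B34 x34).
    rewrite rmorph1 mulr1 => -[E12 E34].
    apply: decomposable_pair_eq0 E12 E34 _ _.
      by rewrite (E _ _ _ 0 B13) ?rmorph0 ?mulr0 // x13 raddf0.
    by rewrite (E _ _ _ 0 B14) ?rmorph0 ?mulr0 // x14 raddf0.
  by rewrite t0 scale0r.
by rewrite addmx_sub.
Qed.

(** The coordinate-free form of [sub_image_mx], obtained through row vectors in a basis of [L]. *)
Lemma lie_image (L : lieAlgType rat) (g : 'End(L)) (mu : rat)
    (x a1 a2 a3 a4 : L) (m12 m34 m13 m14 p1 p2 p3 p4 : {scalar L}) :
    {morph g : u v / lie u v} ->
    (forall w, g w = mu *: w -> w \in <[x]>%VS) ->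
    (forall u v, m12 (lie u v) = p1 u * p2 v - p1 v * p2 u) ->
    (forall u v, m34 (lie u v) = p3 u * p4 v - p3 v * p4 u) ->
    (forall u v, m13 (lie u v) = p1 u * p3 v - p1 v * p3 u) ->
    (forall u v, m14 (lie u v) = p1 u * p4 v - p1 v * p4 u) ->
    [/\ m12 x = 1, m34 x = 1, m13 x = 0 & m14 x = 0] ->
    x = lie a1 a2 + lie a3 a4 ->
  exists y, x = g y - mu *: y.
Proof.
move=> gB ker_g B12 B34 B13 B14 [x12 x34 x13 x14] Dx.
pose e := vbasis {:L}; have eB : basis_of {:L} e := vbasisP _.
pose r : {linear L -> 'rV[rat]_(\dim {:L})} := rVof e.
pose w : {linear 'rV[rat]_(\dim {:L}) -> L} := vecof e.
have rK : cancel r w := rVofK eB.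
have wK : cancel w r := vecofK eB.
pose b u v := r (lie (w u) (w v)).
have b_bil : bilinear_for *:%R *:%R b.
  split=> [v k u u'|u k v v']; rewrite /b.
    by rewrite [w (_ + _)]linearP lieDl lieZl [LHS]linearP.
  by rewrite [w (_ + _)]linearP [lie _ _]linearP [LHS]linearP.
pose B : {bilinear _ -> _ -> _} :=
  HB.pack b (bilinear_isBilinear.Build _ _ _ _ _ _ b b_bil).
pose M := mxof e e g.
have mulM u : u *m M = r (g (w u)) by rewrite /M mul_mxof.
pose c (m : {scalar L}) : 'cV_(\dim {:L}) := \col_i m e`_i.
have cE m u : u *m c m = (m (w u))%:M.
  apply/rowP=> i; rewrite ord1 !mxE mulr1n /w /vecof linear_sum /=.
  by apply: eq_bigr => j _; rewrite linearZ !mxE.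
have cB (m p q : {scalar L}) :
    (forall u v, m (lie u v) = p u * q v - p v * q u) ->
    forall u v, B u v *m c m = wedge_mx (c p) (c q) (u^T *m v).
  move=> mB u v; rewrite cE wedge_mxE !cE rK mB.
  by rewrite ![(_%:M) 0 0]mxE !mulr1n.
have : (r x <= M - mu%:M)%MS.
  apply: (@sub_image_mx _ M mu B (r x) (r a1) (r a2) (r a3) (r a4)
    (c m12) (c m34) (c m13) (c m14) (c p1) (c p2) (c p3) (c p4));
    try exact: cB.
  - by move=> u v; rewrite !mulM /= /b !rK gB.
  - move=> u; rewrite mulmxBr mulM mul_mx_scalar => /(congr1 w).
    rewrite linearB linearZ linear0 /= rK => /eqP.
    rewrite subr_eq0 => /eqP/ker_g/vlineP[k wu].
    by rewrite -[u]wK [w u]wu linearZ scalemx_sub.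
  - by rewrite !cE rK x12 x34 x13 x14 !raddf0.
  by rewrite Dx [r _]linearD /= /b !rK.
case/submxP=> y /(congr1 w); rewrite rK mulmxBr mulM mul_mx_scalar.
by rewrite linearB linearZ /= !rK; exists (w y).
Qed.

(** * Rational roots of integral polynomials *)

(** In [algC], [mu] becomes a rational algebraic integer. *)
Lemma rat_root_monic_int (p : {poly rat}) (mu : rat) :
  p \is monic -> p \is a polyOver Num.int -> root p mu -> mu \is a Num.int.
Proof.
move=> p_monic p_int p_mu; rewrite -Cint_rat; apply: Cint_rat_Aint (Crat_rat _) _.
apply: (@root_monic_Aint (map_poly ratr p)).
- by rewrite fmorph_root.
- by rewrite map_monic.
by apply/polyOverP=> i; rewrite coef_map /= Cint_rat (polyOverP p_int).
Qed.

(** Since [mu] is a root, its product with the integer [q] is minus the constant term; two integers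
    whose product has norm 1 have norm 1. *)
Lemma rat_root_unit_norm (p : {poly rat}) (mu : rat) :
  p \is monic -> p \is a polyOver Num.int -> `|p`_0| = 1 -> root p mu ->
  `|mu| = 1.
Proof.
move=> p_monic p_int p0 p_mu.
have mu_int := rat_root_monic_int p_monic p_int p_mu.
pose q := (drop_poly 1 p).[mu].
have q_int : q \is a Num.int.
  apply: rpred_horner => //; apply/polyOverP=> i.
  by rewrite coef_drop_poly (polyOverP p_int).
have qmu : `|q| * `|mu| = 1.
  rewrite -normrM -p0 -normrN; congr `|_|; apply/eqP; rewrite eqr_oppLR -addr_eq0.
  move: p_mu; rewrite -{1}(poly_take_drop 1 p) /root hornerD hornerM hornerXn.
  rewrite expr1 addrC.
  by rewrite {1}/take_poly poly_def big_ord1 expr0 alg_polyC hornerC.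
have /andP[q0 mu0] : (`|q| != 0) && (`|mu| != 0).
  by rewrite -negb_or -mulf_eq0 qmu oner_eq0.
rewrite !normr_eq0 in q0 mu0.
apply/le_anti; rewrite norm_intr_ge1 // andbT -qmu ler_peMl //.
exact: norm_intr_ge1.
Qed.

(** * Lifting to the graph Lie algebra *)

Section GraphLieTheory.
Variable G : sgraph.
Local Notation N := (graph_lie G).

Definition coordV (x : G) (u : N) : rat := u.1 x.
Definition coordW (p : G * G) (u : N) : rat := vsval u.2 p.

Fact coordV_linear x : scalar (coordV x).
Proof. by move=> k u v; rewrite /coordV !ffunE. Qed.

HB.instance Definition _ x :=
  GRing.isLinear.Build rat N rat *%R (coordV x) (coordV_linear x).

Fact coordW_linear p : scalar (coordW p).
Proof. by move=> k u v; rewrite /coordW /= !ffunE. Qed.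

HB.instance Definition _ p :=
  GRing.isLinear.Build rat N rat *%R (coordW p) (coordW_linear p).

Lemma basis_bracketE (x y : G) p : basis_bracket x y p
  = (edge x y)%:R * ((p == (x, y))%:R - (p == (y, x))%:R).
Proof.
case: p => p1 p2; rewrite /basis_bracket; case: ifP => _; last by rewrite ffunE mul0r.
by rewrite !ffunE /= mul1r -!natrM !mulnb !xpair_eqE.
Qed.

Lemma scale_tensorE k (w : tensorV G) p : (k *: w) p = k * w p.
Proof. by rewrite ffunE. Qed.

Lemma bracketVE u v (p : G * G) :
  bracketV u v p = (edge p.1 p.2)%:R * (u p.1 * v p.2 - v p.1 * u p.2).
Proof.
rewrite /bracketV pair_bigA sum_ffunE /=.
under eq_bigr => q _ do rewrite scale_tensorE basis_bracketE mulrA mulrBr.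
rewrite sumrB (bigD1 p) //= big1 ?addr0 => [|q qp]; last first.
  by rewrite -surjective_pairing eq_sym (negPf qp) mulr0.
rewrite (bigD1 (p.2, p.1)) //= big1 ?addr0 => [|q qp]; last first.
  by case: (eqVneq p) qp => [->|]; rewrite ?mulr0 // -surjective_pairing eqxx.
by rewrite -!surjective_pairing !eqxx !mulr1 edge_sym; ring.
Qed.

Lemma coordW_lie p (u v : N) : coordW p (lie u v) = (edge p.1 p.2)%:R *
  (coordV p.1 u * coordV p.2 v - coordV p.1 v * coordV p.2 u).
Proof.
rewrite /coordW /= vsprojK ?bracketV_in // bracketVE.
by rewrite (mulrC (v.1 _)) (mulrC _ (v.1 _)).
Qed.

Lemma graph_lie_nilpotent u v w : lie (lie u v : N) w = 0.
Proof. by rewrite lieC [lie w _]graph_bracket2 oppr0. Qed.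

Lemma coordW_swap (u : N) x y : coordW (y, x) u = - coordW (x, y) u.
Proof.
rewrite /coordW; have /memv_sumP[w wP ->] := subvsP u.2.
rewrite !sum_ffunE -sumrN; apply: eq_bigr => p /wP/vlineP[k ->].
by rewrite !scale_tensorE !ffunE /=; ring.
Qed.

(** It suffices to check the wedges spanning [spaceW], each supported on an edge and its reverse. *)
Lemma coordW_edge (u : N) p : (edge p.1 p.2)%:R * coordW p u = coordW p u.
Proof.
rewrite /coordW; have /memv_sumP[w wP ->] := subvsP u.2.
rewrite !sum_ffunE mulr_sumr; apply: eq_bigr => q /[dup] eq /wP/vlineP[k ->].
have -> : wedge (basisV q.1) (basisV q.2) = basis_bracket q.1 q.2.
  by rewrite /basis_bracket eq.
rewrite scale_tensorE basis_bracketE eq mul1r mulrCA; congr (_ * _).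
rewrite mulrBr; congr (_ - _).
  by case: (eqVneq p) => [->|]; rewrite ?mulr0 // eq mulr1.
by case: (eqVneq p) => [->|]; rewrite ?mulr0 // edge_sym eq mulr1.
Qed.

Section Lift.
Variable y : G -> N.

(** Sends [vtx x] to [y x] and the bracket of adjacent vertices to the bracket of their images. The
    factor [2^-1] is there because each edge occurs as two ordered pairs with equal
    contributions. *)
Definition graph_lift (u : N) : N :=
  \sum_x coordV x u *: y x
  + 2^-1 *: \sum_p coordW p u *: lie (y p.1) (y p.2).

Fact graph_lift_linear : linear graph_lift.
Proof.
move=> k u v; rewrite /graph_lift scalerDr [X in _ = X]addrACA; congr (_ + _).
  rewrite scaler_sumr -big_split; apply: eq_bigr => x _ /=.
  by rewrite linearP scalerDl scalerA.
rewrite scalerA (mulrC k) -scalerA -scalerDr; congr (_ *: _).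
rewrite scaler_sumr -big_split; apply: eq_bigr => p _ /=.
by rewrite linearP scalerDl scalerA.
Qed.

HB.instance Definition _ :=
  GRing.isLinear.Build rat N N _ graph_lift graph_lift_linear.

(** The second summand of [graph_lift] is a combination of brackets, hence central. *)
Lemma lie_graph_lift u v :
  lie (graph_lift u) (graph_lift v)
  = \sum_p (coordV p.1 u * coordV p.2 v) *: lie (y p.1) (y p.2).
Proof.
have W0 w z : lie (2^-1 *: \sum_p coordW p w *: lie (y p.1) (y p.2)) z = 0.
  rewrite lieC linearZ linear_sum /= big1 ?scaler0 ?oppr0 // => p _.
  by rewrite linearZ /= lieC graph_lie_nilpotent oppr0 scaler0.
rewrite lieDl W0 addr0 linearD /= [X in _ + X]lieC W0 oppr0 addr0.
rewrite -(pair_bigA _ (fun x x' => (coordV x u * coordV x' v) *: lie (y x) (y x'))).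
rewrite lieC linear_sum -sumrN; apply: eq_bigr => x _.
rewrite linearZ /= lieC linear_sum scalerN opprK scaler_sumr.
by apply: eq_bigr => x' _; rewrite linearZ /= scalerA.
Qed.

Lemma graph_lift_morph :
  (forall x x', ~~ edge x x' -> lie (y x) (y x') = 0) ->
  {morph graph_lift : u v / lie u v}.
Proof.
move=> y0 u v; rewrite lie_graph_lift /graph_lift big1 ?add0r => [|x _]; last first.
  by rewrite /coordV ffunE scale0r.
(* On an edge this is [coordW_lie]; otherwise [y0] makes both sides vanish. *)
under eq_bigr => p _.
  have -> : coordW p (lie u v) *: lie (y p.1) (y p.2)
    = (coordV p.1 u * coordV p.2 v) *: lie (y p.1) (y p.2)
      - (coordV p.1 v * coordV p.2 u) *: lie (y p.1) (y p.2).
    rewrite coordW_lie -scalerBl; have [_|/y0->] := boolP (edge _ _).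
      by rewrite mul1r.
    by rewrite !scaler0.
  over.
rewrite sumrB; set S := \sum_p _.
(* Exchanging the two vertices changes the sign of the bracket, so the difference is twice [S],
   which cancels the factor [2^-1]. *)
have -> : \sum_p (coordV p.1 v * coordV p.2 u) *: lie (y p.1) (y p.2) = - S.
  rewrite -(pair_bigA _ (fun x x' => (coordV x v * coordV x' u) *: lie (y x) (y x'))).
  rewrite exchange_big pair_bigA -sumrN; apply: eq_bigr => p _ /=.
  by rewrite lieC scalerN mulrC.
by rewrite opprK -mulr2n -scaler_nat scalerA mulVf // scale1r.
Qed.

End Lift.

Lemma graph_lie_coord_inj (u v : N) :
  (forall x, coordV x u = coordV x v) -> (forall p, coordW p u = coordW p v) ->
  u = v.
Proof.
case: u v => [u u'] [v v'] uv uv'; congr (_, _); first exact/ffunP.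
by apply/val_inj/ffunP.
Qed.

Lemma graph_lift_vtx u : graph_lift (@vtx G) u = u.
Proof.
have coordV_vtx x z : coordV x (vtx z) = (x == z)%:R by rewrite /coordV ffunE.
have coordV_lie x v w : coordV x (lie v w : N) = 0 by rewrite /coordV ffunE.
have coordW_vtx p z : coordW p (vtx z) = 0 by rewrite /coordW linear0 ffunE.
apply: graph_lie_coord_inj => [x|p].
  rewrite linearD linearZ !linear_sum /= [X in _ + _ * X]big1; last first.
    by move=> p _; rewrite linearZ /= coordV_lie mulr0.
  rewrite mulr0 addr0 (bigD1 x) //= big1 ?addr0 => [|z zx].
    by rewrite linearZ /= coordV_vtx eqxx mulr1.
  by rewrite linearZ /= coordV_vtx eq_sym (negPf zx) mulr0.
rewrite linearD linearZ !linear_sum /= big1 ?add0r; last first.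
  by move=> z _; rewrite linearZ /= coordW_vtx mulr0.
have sum1 q : \sum_i coordW i u * (q == i)%:R = coordW q u.
  rewrite (bigD1 q) //= big1 ?addr0 ?eqxx ?mulr1 // => i iq.
  by rewrite eq_sym (negPf iq) mulr0.
under eq_bigr => i _.
  have -> : coordW p (coordW i u *: lie (vtx i.1) (vtx i.2))
    = (edge p.1 p.2)%:R * (coordW i u * (p == i)%:R
                          - coordW i u * ((p.2, p.1) == i)%:R).
    rewrite linearZ /= coordW_lie !coordV_vtx mulrCA mulrBr -!natrM !mulnb.
    case: i p {sum1} => i1 i2 [p1 p2] /=; rewrite !xpair_eqE.
    by rewrite [(p1 == i2) && _]andbC.
  over.
(* The pair [p] and its reverse contribute equally, which again cancels [2^-1]. *)
rewrite -mulr_sumr sumrB !sum1 coordW_swap -surjective_pairing opprK -mulr2n.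
by rewrite -(mulr_natl (coordW _ _)) mulrCA mulKf // coordW_edge.
Qed.

(** By [graph_lift_vtx], every [u] is a combination of vertices and their brackets, on which both
    sides agree. *)
Lemma proj_graph_lift (I : lieIdeal (graph_lie G)) (f : 'End(lie_quot I)) y :
  {morph f : u v / lie u v} ->
  (forall x, lie_proj I (y x) = f (lie_proj I (vtx x))) ->
  forall u, lie_proj I (graph_lift y u) = f (lie_proj I u).
Proof.
move=> f_lie fy u; rewrite -{2}[u]graph_lift_vtx /graph_lift.
rewrite !(linearD, linearZ) /= !linear_sum /=; congr (_ + _).
  by apply: eq_bigr => x _; rewrite !linearZ /= fy.
apply: eq_bigr => p _; congr (_ *: _); rewrite !linearZ /= !lie_projM f_lie.
by rewrite !fy.
Qed.

End GraphLieTheory.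

(** * The quotient by an edge pair *)

Section EdgePair.
Variables (G : sgraph) (a b c d : G).
Hypotheses (abcd : uniq [:: a; b; c; d]) (eab : edge a b) (ecd : edge c d)
  (eac : edge a c) (ead : edge a d).
Local Notation X := (edge_pair a b c d).

Lemma coordW_edge_pair :
  [/\ coordW (a, b) X = 1, coordW (c, d) X = 1,
      coordW (a, c) X = 0 & coordW (a, d) X = 0].
Proof.
move: abcd; rewrite /= !inE !negb_or => /and4P[/and3P[ab ac ad] /andP[bc bd] cd _].
rewrite !linearD /= !coordW_lie /= eab ecd eac ead /coordV !ffunE !eqxx.
rewrite ![b == _]eq_sym ![c == _]eq_sym ![d == _]eq_sym.
rewrite (negPf ab) (negPf ac) (negPf ad) (negPf bc) (negPf bd) (negPf cd).
by rewrite !(mulr0, mul0r, mulr1, subr0, addr0, add0r).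
Qed.

(** A bracket retains the minors of [u] and [v] at edges; those at [ab], [cd], [ac], [ad] fit
    [decomposable_pair_eq0], with [t] the coefficient of [X]. *)
Lemma lie_edge_pair_eq0 (u v : graph_lie G) : lie u v \in <[X]>%VS -> lie u v = 0.
Proof.
case: coordW_edge_pair => Xab Xcd Xac Xad /vlineP[t uvX].
have E p k : edge p.1 p.2 -> coordW p X = k ->
    coordV p.1 u * coordV p.2 v - coordV p.1 v * coordV p.2 u = t * k.
  move=> e <-; have /(congr1 (coordW p)) := uvX.
  by rewrite coordW_lie e mul1r linearZ.
have := E (a, b) _ eab Xab; rewrite mulr1 => Eab.
have := E (c, d) _ ecd Xcd; rewrite mulr1 => Ecd.
have := E (a, c) _ eac Xac; rewrite mulr0 => Eac.
have := E (a, d) _ ead Xad; rewrite mulr0 => Ead.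
by rewrite uvX (decomposable_pair_eq0 Eab Ecd Eac Ead) scale0r.
Qed.

Lemma graph_quot_eigenvector (f : 'End(graph_quot a b c d)) :
  {morph f : u v / lie u v} -> exists mu : rat, exists2 q, q != 0 & f q = mu *: q.
Proof.
move=> f_lie; pose I := central_line (@edge_pair_central G a b c d).
pose y x : graph_lie G := lie_repr (f (lie_proj I (vtx x))).
have y_proj x : lie_proj I (y x) = f (lie_proj I (vtx x)) by rewrite /y lie_reprK.
have y0 x x' : ~~ edge x x' -> lie (y x) (y x') = 0.
  move=> exx'; apply: lie_edge_pair_eq0.
  have : lie_proj I (lie (y x) (y x')) == 0.
    rewrite lie_projM !y_proj -f_lie -lie_projM lie_vtx /basis_bracket.
    by rewrite (negPf exx') linear0 !linear0.
  by rewrite lie_proj_eq0.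
have g_proj := proj_graph_lift f_lie y_proj.
pose g : 'End(graph_lie G) := linfun (graph_lift y).
have gE u : g u = graph_lift y u by rewrite lfunE.
have projX : lie_proj I X = 0 by apply/eqP; rewrite lie_proj_eq0 memv_line.
(* As [g] induces [f], it preserves the kernel of the projection; its factor there is the candidate
   eigenvalue. *)
have /vlineP[mu gX] : g X \in <[X]>%VS.
  by rewrite gE -[_ \in _](lie_proj_eq0 I) g_proj projX linear0.
(* A nonzero kernel of [f - mu] yields the eigenvector; the injective case is refuted below. *)
exists mu; have [/lker0P f_inj|] := boolP (lker (f - mu *: \1%VF) == 0%VS); last first.
  rewrite -vpick0 => q0; exists (vpick (lker (f - mu *: \1%VF))) => //.
  have := memv_pick (lker (f - mu *: \1%VF)).
  by rewrite memv_ker add_lfunE opp_lfunE scale_lfunE id_lfunE subr_eq0 => /eqP.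
have ker_f q : f q = mu *: q -> q = 0.
  move=> fq; apply: f_inj; rewrite add_lfunE opp_lfunE scale_lfunE id_lfunE fq subrr.
  by rewrite linear0.
have ker_g w : g w = mu *: w -> w \in <[X]>%VS.
  move=> gw; rewrite -[_ \in _](lie_proj_eq0 I); apply/eqP/ker_f.
  by rewrite -g_proj -gE gw linearZ.
have [Xab Xcd Xac Xad] := coordW_edge_pair.
have coordW_lie_edge (p : G * G) u v : edge p.1 p.2 -> coordW p (lie u v)
    = coordV p.1 u * coordV p.2 v - coordV p.1 v * coordV p.2 u.
  by move=> e; rewrite coordW_lie e mul1r.
have [z Xz] : exists z, X = g z - mu *: z.
  apply: (@lie_image _ g mu X (vtx a) (vtx b) (vtx c) (vtx d)
    (coordW (a, b)) (coordW (c, d)) (coordW (a, c)) (coordW (a, d))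
    (coordV a) (coordV b) (coordV c) (coordV d)) => //.
  - by move=> u v; rewrite !gE graph_lift_morph.
  - by move=> u v; apply: (coordW_lie_edge (a, b)).
  - by move=> u v; apply: (coordW_lie_edge (c, d)).
  - by move=> u v; apply: (coordW_lie_edge (a, c)).
  - by move=> u v; apply: (coordW_lie_edge (a, d)).
(* Projecting [X = g z - mu *: z] shows that [f - mu] kills the class of [z]. So [z] is a multiple
   of [X], where [g - mu] vanishes, and [X = 0] contradicts its coordinate 1 at [ab]. *)
have /vlineP[t zX] : z \in <[X]>%VS.
  rewrite -[_ \in _](lie_proj_eq0 I); apply/eqP/ker_f.
  by rewrite -g_proj -gE -[g z](subrK (mu *: z)) -Xz lie_projD projX add0r linearZ.
move: Xz; rewrite zX linearZ /= gX scalerA mulrC -scalerA subrr => X0.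
by move: Xab; rewrite X0 linear0 => /eqP; rewrite eq_sym oner_eq0.
Qed.

End EdgePair.

Theorem theorem5p1 (G : sgraph) (a b c d : G) :
  uniq [:: a; b; c; d] ->
  edge a b -> edge c d -> edge a c -> edge a d ->
  ~ exists f : 'End(graph_quot a b c d),
      [/\ lie_automorphism f,
          hyperbolic f,
          end_char_poly f \is a polyOver Num.int
        & (end_char_poly f)`_0 = 1 \/ (end_char_poly f)`_0 = -1].
Proof.
move=> abcd eab ecd eac ead [f [[_ f_lie] f_hyp f_int f0]].
have [mu [q q0 fq]] := graph_quot_eigenvector abcd eab ecd eac ead f_lie.
have f_mu : eigenvalue (end_mx f) mu.
  apply/eigenvalueP; exists (rVof (vbasis {:graph_quot a b c d}) q).
    by rewrite -rVof_app ?vbasisP // fq linearZ.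
  by rewrite rVof_eq0 ?vbasisP.
(* Seen in [algC], the rational eigenvalue has modulus 1 by [rat_root_unit_norm], which
   hyperbolicity forbids. *)
have := f_hyp (ratr mu).
rewrite !eigenvalue_root_char -map_char_poly fmorph_root in f_mu *.
rewrite -ratr_norm (rat_root_unit_norm _ f_int _ f_mu) ?char_poly_monic //.
  by rewrite rmorph1 eqxx => /(_ f_mu).
by case: f0 => ->; rewrite ?normrN normr1.
Qed.
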